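(* Every metrisable partially ordered compact space is $\aleph_1$-copresentable in $\mathsf{PosComp}$.
   Context: A partially ordered compact space is a triple $(X,\leq,\tau)$ where $\leq$ is a partial order on the set $X$ and $\tau$ is a compact topology on $X$ such that $\{(x,y)\mid x\leq y\}$ is closed in $X\times X$. $\mathsf{PosComp}$ is the category of these spaces and monotone continuous maps. An object $X$ of a category $\mathsf{C}$ is $\aleph_1$-copresentable if $\hom(-,X)\colon\mathsf{C}^{\mathrm{op}}\to\mathsf{Set}$ preserves $\aleph_1$-filtered (equivalently, $\aleph_1$-directed) colimits, i.e. it sends limits of $\aleph_1$-codirected diagrams in $\mathsf{C}$ to colimits in $\mathsf{Set}$. A metric space here is a pair $(X,a)$ with $a\colon X\times X\to[0,1]$ satisfying $a(x,x)=0$ and $a(x,z)\leqslant\min(1,a(x,y)+a(y,z))$ for all $x,y,z\in X$ (no symmetry or separation required). The order induced by $a$ is: $x\leq y$ iff $a(x,y)=0$. The topology induced by $a$ is the one induced by the symmetrisation $a_s(x,y)=\max(a(x,y),a(y,x))$. A partially ordered compact space $X$ is metrisable if there is a metric (in this sense) on $X$ inducing both the order and the topology of $X$. *)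

(* Defs.v *)
From HB Require Import structures.
From mathcomp Require Import all_boot all_order all_algebra.
From mathcomp Require Import all_classical all_reals topology.

Set Implicit Arguments.
Unset Strict Implicit.
Unset Printing Implicit Defensive.

Import Order.TTheory GRing.Theory Num.Theory.

Local Open Scope classical_set_scope.
Local Open Scope ring_scope.

Record category := Category {
  obj :> Type;
  hom : obj -> obj -> Type;
  idm : forall x, hom x x;
  compm : forall x y z, hom y z -> hom x y -> hom x z;
  compm1 : forall x y (f : hom x y), compm f (idm x) = f;
  comp1m : forall x y (f : hom x y), compm (idm y) f = f;
  compmA : forall x y z t (h : hom z t) (g : hom y z) (f : hom x y),
    compm h (compm g f) = compm (compm h g) f }.

Arguments idm {c} x.
Arguments compm {c x y z}.

Record functor (C D : category) := Functor {
  fobj :> C -> D;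
  fmap : forall x y, hom x y -> hom (fobj x) (fobj y);
  fmap_id : forall x, fmap (idm x) = idm (fobj x);
  fmap_comp : forall x y z (g : hom y z) (f : hom x y),
    fmap (compm g f) = compm (fmap g) (fmap f) }.

Arguments fmap {C D} _ {x y} _.

Definition opposite (C : category) : category :=
  @Category C (fun x y => hom y x) (fun x => idm x)
    (fun x y z g f => compm f g)
    (fun x y f => comp1m f) (fun x y f => compm1 f)
    (fun x y z t h g f => esym (compmA f g h)).

Definition SET : category :=
  @Category Type (fun A B => A -> B) (fun A x => x)
    (fun A B C g f x => g (f x))
    (fun A B f => erefl) (fun A B f => erefl) (fun A B C D h g f => erefl).

Definition poset_category d (I : porderType d) : category :=
  @Category I (fun i j => (i <= j)%O) (fun i => lexx i)
    (fun i j k jk ij => le_trans ij jk)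
    (fun _ _ _ => Prop_irrelevance _ _)
    (fun _ _ _ => Prop_irrelevance _ _)
    (fun _ _ _ _ _ _ _ => Prop_irrelevance _ _).

Record cocone (J C : category) (D : functor J C) := Cocone {
  apex : C;
  leg : forall j : J, hom (D j) apex;
  leg_natural : forall (i j : J) (u : hom i j),
    compm (leg j) (fmap D u) = leg i }.

Arguments apex {J C D}.
Arguments leg {J C D} _ _.

Definition is_colimit (J C : category) (D : functor J C) (L : cocone D) :=
  forall K : cocone D,
    exists! h : hom (apex L) (apex K), forall j, compm h (leg L j) = leg K j.

Definition comp_functor (A B C : category) (G : functor B C) (F : functor A B)
  : functor A C.
Proof.
refine (@Functor A C (fun x => G (F x)) (fun x y f => fmap G (fmap F f)) _ _).
- by move=> x; rewrite !fmap_id.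
- by move=> x y z g f; rewrite !fmap_comp.
Defined.

Definition map_cocone (J A B : category) (F : functor A B) (D : functor J A)
  (L : cocone D) : cocone (comp_functor F D).
Proof.
refine (@Cocone J B (comp_functor F D) (F (apex L))
  (fun j => fmap F (leg L j)) _).
by move=> i j u /=; rewrite -fmap_comp leg_natural.
Defined.

(* In particular [I] is nonempty (take [A] empty). *)
Definition aleph1_directed d (I : porderType d) :=
  forall A : set I, countable A -> exists u : I, forall i, A i -> (i <= u)%O.

Definition preserves_aleph1_directed_colimits (A B : category)
  (F : functor A B) :=
  forall d (I : porderType d), aleph1_directed I ->
  forall (D : functor (poset_category I) A) (L : cocone D),
    is_colimit L -> is_colimit (map_cocone F L).

Definition hom_to (C : category) (X : C) : functor (opposite C) SET.
Proof.
refine (@Functor (opposite C) SET (fun Y => @hom C Y X)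
  (fun Y Z f => fun g => @compm C Z Y X g f) _ _).
- by move=> Y; apply/funext => g /=; rewrite compm1.
- by move=> Y Z W g f; apply/funext => h /=; rewrite compmA.
Defined.

(* Colimits in [opposite C] are limits in [C], and functors from an
   aleph1-directed poset to [opposite C] are aleph1-codirected diagrams in
   [C]. *)
Definition aleph1_copresentable (C : category) (X : C) :=
  preserves_aleph1_directed_colimits (hom_to X).

(* As in [compact], no separation is required; Hausdorffness follows from
   [pc_closed]. *)
Record poscomp := PosComp {
  pc_disp : Order.disp_t;
  pc_sort :> POrderedTopological.type pc_disp;
  pc_compact : compact [set: pc_sort];
  pc_closed : closed [set p : pc_sort * pc_sort | (p.1 <= p.2)%O] }.

Record poscomp_map (X Y : poscomp) := PosCompMap {
  pcm_fun :> X -> Y;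
  pcm_homo : {homo pcm_fun : x y / (x <= y)%O};
  pcm_continuous : continuous pcm_fun }.

Lemma poscomp_map_ext (X Y : poscomp) (f g : poscomp_map X Y) :
  f =1 g -> f = g.
Proof.
case: f g => [f f1 f2] [g g1 g2] /= /funext fg; subst g.
by congr PosCompMap; exact: Prop_irrelevance.
Qed.

Definition poscomp_id (X : poscomp) : poscomp_map X X :=
  @PosCompMap X X id (fun _ _ xy => xy) (fun x => cvg_id).

Definition poscomp_comp (X Y Z : poscomp) (g : poscomp_map Y Z)
  (f : poscomp_map X Y) : poscomp_map X Z :=
  @PosCompMap X Z (g \o f)
    (fun _ _ xy => pcm_homo g (pcm_homo f xy))
    (fun x => continuous_comp (@pcm_continuous _ _ f x)
                              (@pcm_continuous _ _ g (f x))).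

Definition POSCOMP : category.
Proof.
refine (@Category poscomp poscomp_map poscomp_id poscomp_comp _ _ _);
  by move=> *; exact: poscomp_map_ext.
Defined.

(* Neither symmetric nor separated. *)
Definition is_metric (R : realType) (X : Type) (a : X -> X -> R) :=
  [/\ forall x y, 0 <= a x y <= 1,
      forall x, a x x = 0 &
      forall x y z, a x z <= Num.min 1 (a x y + a y z)].

Definition symmetrisation (R : realType) (X : Type) (a : X -> X -> R)
  (x y : X) : R :=
  Num.max (a x y) (a y x).

Definition induces_order (R : realType) d (X : porderType d)
  (a : X -> X -> R) :=
  forall x y : X, (x <= y)%O <-> a x y = 0.

Definition induces_topology (R : realType) (X : topologicalType)
  (a : X -> X -> R) :=
  forall x : X,
    nbhs x = nbhs_ball_ (fun x e => [set y | symmetrisation a x y < e]) x.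

Definition metrisable (R : realType) (X : poscomp) :=
  exists a : X -> X -> R,
    [/\ is_metric a, induces_order a & induces_topology a].

(* Main.v *)
Require Import Defs.
From mathcomp Require Import all_boot all_order all_algebra.
From mathcomp Require Import all_classical all_reals topology.

Set Implicit Arguments.
Unset Strict Implicit.
Unset Printing Implicit Defensive.

Import Order.TTheory GRing.Theory Num.Theory.

Local Open Scope classical_set_scope.

(** Let [D] be an aleph1-codirected diagram of partially ordered compact spaces
    with limit [L] and projections [p_i : L -> D_i]. That [hom(-, X)] turns this
    limit into a colimit of sets means that every morphism [f : L -> X] is
    [g \o p_i] for some [i] and some [g : D_i -> X]
    ([factors_through_vertex]), and that two such [g], [g'] with the same
    composite with [p_i] already agree on the image of some [D_j -> D_i]
    ([factorization_unique]).

    The metric of [X] enters through the fact that the order of [X] is a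
    countable intersection of open sets [U_n] of [X * X], namely
    [U_n = {a < 1 / (n + 1)}] ([metrisable_gdelta_order]). Each [U_n] is an
    open condition, which compactness moves from [L] to some vertex of the
    diagram; an index above countably many such vertices handles all the [n]
    together. This is where aleph1-codirectedness enters.

    The transfer principle is [bond_image_avoids]: a closed subset of [D_i]
    that misses [p_i(L)] misses the image of some [D_j]. Otherwise, by
    Tychonoff, there is a thread whose [i]-th coordinate lies in the closed
    set, and threads are points of [L]. Uniqueness is immediate from it.

    For existence, one first finds [i] such that [p_i l <= p_i l'] implies
    [f l <= f l'], so that [f] is a monotone function of [p_i]. The remaining
    problem is to extend this function from the closed set [p_i(L)] to all of
    some [D_k]. The extension is built as a relation. Let [G] be the graph
    [{(p_i l, f l)}], a compact subset of [D_i * X]. It has closed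
    neighbourhoods [N_n] such that [z <= z'], [N_n(z, x)] and [N_n(z', x')]
    imply [U_n(x, x')]. By the transfer principle, for [k] large enough every
    [z] in [D_k] admits, for each [n], some [x] related to its image in [D_i]
    by [N_0], ..., [N_n]; by compactness of [X], one [x] works for all [n]. The
    relation between [z] and [x] given by all the [N_n] is thus total on [D_k],
    and it is monotone because the [U_n] intersect in the order; by
    antisymmetry it is a function. Its graph is closed, so it is continuous. *)

(** * Directed index sets and compactness *)

Lemma aleph1_directed_ub2 d (I : porderType d) : aleph1_directed I ->
  forall i j : I, exists k, (i <= k)%O /\ (j <= k)%O.
Proof.
move=> dirI i j; have [] := dirI [set i; j].
  by apply: finite_set_countable; exact: finite_set2.
by move=> k ub; exists k; split; apply: ub; [left | right].
Qed.

Lemma aleph1_directed_seq d (I : porderType d) : aleph1_directed I ->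
  forall u : nat -> I, exists k, forall n, (u n <= k)%O.
Proof.
move=> dirI u; have [] := dirI (range u); first exact: card_image_le.
by move=> k ub; exists k => n; apply: ub; exists n.
Qed.

(** Otherwise the closed sets [C j] eventually avoid a neighbourhood of each
    point, hence eventually avoid the whole space, by the near-covering form of
    compactness for the filter of tails of [I]. *)
Lemma compact_directed_bigcap (T : topologicalType) d (I : porderType d)
    (C : I -> set T) :
  compact [set: T] -> inhabited I ->
  (forall i j : I, exists k, (i <= k)%O /\ (j <= k)%O) ->
  (forall i, closed (C i)) -> (forall i, C i !=set0) ->
  (forall i j, (i <= j)%O -> C j `<=` C i) ->
  exists t, forall i, C i t.
Proof.
move=> /compact_near_coveringP cT [i0] dirI clC C0 antiC.
apply: contrapT => /forallNP noC.
pose F := filter_from [set: I] (fun i => [set j | (i <= j)%O]).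
have FF : Filter F.
  apply: filter_from_filter; first by exists i0.
  move=> i j _ _; have [k [ik jk]] := dirI i j; exists k => // l /= kl.
  by split; [exact: le_trans ik kl | exact: le_trans jk kl].
have [] := cT _ F (fun j t => ~ C j t) FF.
  move=> t _; have /existsNP[i Cit] := noC t.
  exists (~` C i, [set j | (i <= j)%O]).
    split=> /=; last by exists i.
    by apply: open_nbhs_nbhs; split => //; exact: closed_openC.
  by move=> [t' j] [/= Ct' ij] /antiC - /(_ _ ij).
move=> i _ /(_ i (lexx i)) Ci.
by have [t Cit] := C0 i; exact: (Ci t).
Qed.

(** A point [v] that cannot be separated from [u] yields pairs [(w, w)] of
    the order relation arbitrarily close to [(u, v)] and to [(v, u)]. *)
Lemma closed_order_hausdorff d (T : POrderedTopological.type d) :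
  closed [set p : T * T | (p.1 <= p.2)%O] -> hausdorff_space T.
Proof.
move=> cl x y xy.
have clE (u v : T) : cluster (nbhs u) v -> (u <= v)%O.
  move=> uv; apply: (cl (u, v)) => A [[/= B C] [uB vC] BCA].
  have [w [Bw Cw]] := uv _ _ uB vC.
  by exists (w, w); split=> //=; apply: BCA.
apply: le_anti; rewrite !clE //.
by move=> A B yA xB; rewrite setIC; exact: xy.
Qed.

(** The tube lemma. *)
Lemma compact_rel_nbhs (S T : topologicalType) (K : set T) (O : set (S * T))
    (x : S) :
  compact K -> open O -> (forall y, K y -> O (x, y)) ->
  nbhs x [set x' | forall y, K y -> O (x', y)].
Proof.
move=> /compact_near_coveringP cK oO KO.
apply: (cK _ (nbhs x) (fun x' y => O (x', y))) => y Ky.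
have : nbhs (x, y) O by apply: open_nbhs_nbhs; split => //; exact: KO.
move=> [[A B] /= [xA yB] ABO]; exists (B, A) => //= -[y' x'] [/= By' Ax'].
exact: ABO.
Qed.

(** Normality applied once in each variable: the tube lemma first gives a
    neighbourhood of [K] related by [O] to all of [K]; it contains a closed
    neighbourhood [V], and the tube lemma along [V] then gives a neighbourhood
    of [K] to which all of [V] is related. A closed set inside both will do. *)
Lemma closed_nbhs_square (T : topologicalType) (K : set T) (O : set (T * T)) :
  hausdorff_space T -> compact [set: T] -> closed K -> open O ->
  (forall x y, K x -> K y -> O (x, y)) ->
  exists N : set T, [/\ closed N, forall x, K x -> nbhs x N &
    forall x y, N x -> N y -> O (x, y)].
Proof.
move=> hT cT clK oO KO.
have cpt (A : set T) : closed A -> compact A.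
  by move=> clA; exact: subclosed_compact clA cT _.
have [|V1 KV1 V1O] := compact_normal hT cT clK
    (t := [set x | forall y, K y -> O (x, y)]).
  by move=> x Kx; apply: compact_rel_nbhs => // [|y Ky]; [exact: cpt|exact: KO].
pose O' := [set p : T * T | O (p.2, p.1)].
have oO' : open O'.
  have : continuous (fun p : T * T => (p.2, p.1)).
    by move=> p; apply: cvg_pair => //; [exact: cvg_snd | exact: cvg_fst].
  by move/continuousP; apply.
have [|V2 KV2 V2O] := compact_normal hT cT clK
    (t := [set y | forall x, closure V1 x -> O' (y, x)]).
  move=> y Ky; apply: compact_rel_nbhs => // [|x /V1O]; last exact.
  by apply: cpt; exact: closed_closure.
exists (closure V1 `&` closure V2); split.
- by apply: closedI; exact: closed_closure.
- move=> x Kx; apply: filterI.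
    by apply: filterS (KV1 x Kx); exact: subset_closure.
  by apply: filterS (KV2 x Kx); exact: subset_closure.
- by move=> x y [V1x _] [_ /V2O]; exact.
Qed.

(** * Products of spaces and functions with closed graph *)

Lemma closed_eqfun (S T : topologicalType) (f g : S -> T) :
  hausdorff_space T -> continuous f -> continuous g ->
  closed [set s | f s = g s].
Proof.
move=> hT cf cg s cls; apply: hT => A B fA gB.
have fgAB : nbhs s (f @^-1` A `&` g @^-1` B).
  by apply: filterI; [exact: cf | exact: cg].
have [u [fgu [/= Au Bu]]] := cls _ fgAB.
by exists (f u); split=> //; rewrite fgu.
Qed.

Lemma continuous_pairmap (S S' T T' : topologicalType) (f : S -> S')
  (g : T -> T') : continuous f -> continuous g ->
  continuous (fun p : S * T => (f p.1, g p.2)).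
Proof.
move=> cf cg p; apply: cvg_pair.
  by apply: cvg_comp; [exact: cvg_fst | exact: cf].
by apply: cvg_comp; [exact: cvg_snd | exact: cg].
Qed.

Lemma continuous_pairing (S T T' : topologicalType) (f : S -> T) (g : S -> T') :
  continuous f -> continuous g -> continuous (fun s => (f s, g s)).
Proof. by move=> cf cg s; apply: cvg_pair; [exact: cf | exact: cg]. Qed.

Lemma hausdorff_setX (S T : topologicalType) :
  hausdorff_space S -> hausdorff_space T -> hausdorff_space (S * T)%type.
Proof.
move=> hS hT [a b] [c e] abce.
congr pair; [apply: hS => A B aA cB | apply: hT => A B bA eB].
  have [||[u v] [/= [Au _] [Bu _]]] := abce (A `*` setT) (B `*` setT).
  - by exists (A, setT) => //; split=> //; exact: filterT.
  - by exists (B, setT) => //; split=> //; exact: filterT.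
  by exists u.
have [||[u v] [/= [_ Av] [_ Bv]]] := abce (setT `*` A) (setT `*` B).
- by exists (setT, A) => //; split=> //; exact: filterT.
- by exists (setT, B) => //; split=> //; exact: filterT.
by exists v.
Qed.

(** For each [t], points near [(s, t)] are either off the graph or have their
    second coordinate in the given neighbourhood of [g s]; compactness makes
    this uniform in [t], in particular valid for [t = g s']. *)
Lemma closed_graph_continuous (S T : topologicalType) (g : S -> T) :
  compact [set: T] -> closed [set p : S * T | p.2 = g p.1] -> continuous g.
Proof.
move=> /compact_near_coveringP cT clg s A gA.
have := cT _ (nbhs s) (fun s' t => t = g s' -> A t) _.
move=> cov; apply: filterS (cov _ _) => [s' /= covs'|t _]; first exact: covs'.
have [tg|tNg] := pselect (t = g s).
  exists (A, setT); first by split=> /=; [rewrite tg | exact: filterT].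
  by move=> [t' s'] [/=].
have : nbhs (s, t) (~` [set p : S * T | p.2 = g p.1]).
  by apply: open_nbhs_nbhs; split => //; exact: closed_openC.
move=> [[B C] /= [sB tC] BC]; exists (C, B) => //= -[t' s'] [/= Ct' Bs'] t'g.
by case: (BC (s', t')).
Qed.

(** * The order of a metrisable space *)

Lemma poscomp_hausdorff (X : poscomp) : hausdorff_space X.
Proof. by apply: closed_order_hausdorff; exact: pc_closed. Qed.

(** The form in which metrisability is used: countably many open conditions
    in place of a real-valued distance. *)
Definition gdelta_order (X : poscomp) :=
  exists U : nat -> set (X * X),
  (forall n, open (U n)) /\
  forall x y : X, (x <= y)%O <-> forall n, U n (x, y).

(** By the triangle inequality [a] is upper semicontinuous for the topology of
    its symmetrisation, and [a x y = 0] exactly when [a x y < 1 / (n + 1)] for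
    all [n]. *)
Lemma metrisable_gdelta_order (R : realType) (X : poscomp) :
  metrisable R X -> gdelta_order X.
Proof.
move=> [a [[a01 axx atri] ord top]].
have tri x y z : (a x z <= a x y + a y z)%R.
  by apply: le_trans (atri x y z) _; rewrite ge_min lexx orbT.
exists (fun n => [set p | (a p.1 p.2 < n.+1%:R^-1)%R]); split.
  move=> n; rewrite openE => -[x y] /= axy.
  set e := (n.+1%:R^-1)%R in axy *.
  have d0 : (0 < (e - a x y) / 2)%R by rewrite divr_gt0 ?subr_gt0 ?ltr0n.
  have nb (z : X) :
      nbhs z [set z' | (symmetrisation a z z' < (e - a x y) / 2)%R].
    by rewrite top; exists ((e - a x y) / 2)%R.
  exists ([set z' | (symmetrisation a x z' < (e - a x y) / 2)%R],
          [set z' | (symmetrisation a y z' < (e - a x y) / 2)%R]).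
    by split; exact: nb.
  move=> [x' y'] [/=]; rewrite /symmetrisation !gt_max => /andP[_ x'x].
  move=> /andP[yy' _]; apply: le_lt_trans (tri x' x y') _.
  rewrite -[ltRHS](subrK (a x y)) [X in (_ < X + _)%R]splitr.
  apply: le_lt_trans (lerD (lexx _) (tri x y y')) _.
  by rewrite addrCA [ltRHS]addrC ltrD2l; exact: ltrD.
move=> x y; split=> [/ord axy0 n|axy]; first by rewrite /= axy0 invr_gt0 ltr0n.
apply/ord/le_anti/andP; split; last by case/andP: (a01 x y).
rewrite leNgt; apply/negP => /ltr_add_invr[n]; rewrite add0r => an.
by have := lt_trans (axy n) an; rewrite ltxx.
Qed.

(** The two-element chain is a test object: its maps into a space are the pairs
    [x <= y] of that space, and its constant maps are the points. It thereby
    reads off the order and the points of a limit from the universal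
    property. *)
Definition bool_poscomp : poscomp.
Proof.
apply: (@PosComp _ (bool : POrderedTopological.type _)).
- by apply: finite_compact; exact: finite_finset.
- move=> -[x y] clxy; have [|[u v] [/= uv [<- <-]]] := clxy [set (x, y)].
    exists ([set x], [set y]); first by split; exact: discrete_set1.
    by move=> [x' y'] [/= -> ->].
  by [].
Defined.

(** * Codirected limits of partially ordered compact spaces *)

Section CodirectedLimit.
Variables (d : Order.disp_t) (I : porderType d).
Hypothesis dirI : aleph1_directed I.
Variables (D : functor (poset_category I) (opposite POSCOMP)) (L : cocone D).
Hypothesis limL : is_colimit L.

Definition vertex (i : I) : poscomp := fobj D i.
Definition bond (i j : I) (ij : (i <= j)%O) : poscomp_map (vertex j) (vertex i)
  := @Defs.fmap _ _ D i j ij.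
Definition limobj : poscomp := apex L.
Definition prj i : poscomp_map limobj (vertex i) := leg L i.

Lemma bond_refl i (ii : (i <= i)%O) z : bond ii z = z.
Proof.
have -> : ii = lexx i by exact: Prop_irrelevance.
by have := @Defs.fmap_id _ _ D i; rewrite /bond => /= ->.
Qed.

Lemma bond_bond i j k (ij : (i <= j)%O) (jk : (j <= k)%O) (ik : (i <= k)%O) z :
  bond ij (bond jk z) = bond ik z.
Proof.
have -> : ik = le_trans ij jk by exact: Prop_irrelevance.
by have := @Defs.fmap_comp _ _ D i j k jk ij; rewrite /bond => /= ->.
Qed.

Lemma bond_prj i j (ij : (i <= j)%O) l : bond ij (prj j l) = prj i l.
Proof. by have := @leg_natural _ _ _ L i j ij; rewrite /prj => <-. Qed.

(** The universal property of the limit, which is that of a colimit in the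
    opposite category. *)
Lemma lift_cone (Z : poscomp) (c : forall i, poscomp_map Z (vertex i)) :
  (forall i j (ij : (i <= j)%O) z, bond ij (c j z) = c i z) ->
  exists! h : poscomp_map Z limobj, forall i z, prj i (h z) = c i z.
Proof.
move=> cE.
have nat (i j : poset_category I) (u : Defs.hom i j) :
    @compm (opposite POSCOMP) _ _ _ (c j : @Defs.hom (opposite POSCOMP) (D j) Z)
      (Defs.fmap D u) = c i.
  by apply: poscomp_map_ext => z; exact: cE.
have [h [hE hU]] := limL (Cocone nat).
exists h; split=> [i z|h' h'E].
  exact: (congr1 (fun k : poscomp_map Z (vertex i) => k z) (hE i)).
by apply: hU => i; apply: poscomp_map_ext => z; exact: h'E.
Qed.

Lemma constant_homo (Y Z : poscomp) (y : Y) :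
  {homo (fun _ : Z => y) : u v / (u <= v)%O}.
Proof. by []. Qed.

Definition constant_map (Z Y : poscomp) (y : Y) : poscomp_map Z Y :=
  PosCompMap (@constant_homo Y Z y) (fun z => @cst_continuous Z Y y z).

(** Constant maps at [l] and [l'] mediate the same cone. *)
Lemma prj_inj l l' : (forall i, prj i l = prj i l') -> l = l'.
Proof.
move=> ll'.
have [|h [_ hU]] := @lift_cone bool_poscomp
  (fun i => constant_map _ (prj i l)).
  by move=> i j ij z /=; exact: bond_prj.
have hl := hU (constant_map _ l) (fun _ _ => erefl).
have hl' : h = constant_map _ l' by apply: hU => i z /=; rewrite ll'.
have := congr1 (fun k : poscomp_map bool_poscomp limobj => k true) hl'.
by rewrite hl.
Qed.

(** The pairs [prj i l <= prj i l'] form a cone under the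
    two-element chain; the map it induces sends [false] to [l] and [true] to
    [l']. *)
Lemma prj_le l l' : (forall i, (prj i l <= prj i l')%O) -> (l <= l')%O.
Proof.
move=> ll'.
have homo i : {homo (fun b : bool_poscomp => prj i (if b then l' else l))
    : u v / (u <= v)%O}.
  by move=> [] [].
have cont i : continuous (fun b : bool_poscomp => prj i (if b then l' else l)).
  move=> b A /nbhs_singleton Ab.
  apply: (@filterS bool (nbhs (b : bool)) _ [set (b : bool)]).
    by move=> _ ->.
  exact: discrete_set1.
have [|h [hE _]] := @lift_cone bool_poscomp
  (fun i => PosCompMap (homo i) (cont i)).
  by move=> i j ij z /=; exact: bond_prj.
have -> : l = h false by apply: prj_inj => i; rewrite hE.
have -> : l' = h true by apply: prj_inj => i; rewrite hE.
exact: pcm_homo.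
Qed.

Lemma lift_thread (t : forall i, vertex i) :
  (forall i j (ij : (i <= j)%O), bond ij (t j) = t i) ->
  exists l, forall i, prj i l = t i.
Proof.
move=> tE.
have [|h [hE _]] := @lift_cone bool_poscomp (fun i => constant_map _ (t i)).
  by move=> i j ij z; exact: tE.
by exists (h true) => i; exact: hE.
Qed.

(** If the image of every [vertex j] met [K], the families of points that are
    compatible below [j] and whose [i]-th coordinate is in [K] would be
    nonempty closed subsets of the product of all vertices, decreasing in [j].
    A common element would be a thread, that is, a point of the limit that
    [prj i] sends to [K]. *)
Lemma bond_image_avoids i (K : set (vertex i)) : closed K ->
  (forall l, ~ K (prj i l)) ->
  exists j (ij : (i <= j)%O), forall z, ~ K (bond ij z).
Proof.
move=> clK Kproj; apply: contrapT => noj.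
have K0 j (ij : (i <= j)%O) : exists z, K (bond ij z).
  by apply: contrapT => /forallNP ?; apply: noj; exists j, ij.
pose T : topologicalType :=
  prod_topology (fun i : I => vertex i : topologicalType).
pose coord k (t : T) : vertex k := t k.
have coord_cont k : continuous (coord k).
  exact: (@proj_continuous I (fun i => vertex i) k).
pose C j := [set t : T | K (coord i t) /\
  forall k (kj : (k <= j)%O), bond kj (coord j t) = coord k t].
have CC j j' : (j <= j')%O -> C j' `<=` C j.
  move=> jj' t [Kt tE]; split=> // k kj.
  by rewrite -(tE _ jj') (bond_bond _ _ (le_trans kj jj')).
have pt k : exists x : vertex k, True.
  have [u [ku iu]] := aleph1_directed_ub2 dirI k i.
  by have [z _] := K0 u iu; exists (bond ku z).
have [||||||t tC] := @compact_directed_bigcap T d I C.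
- have := @tychonoff I (fun i => vertex i : topologicalType) (fun=> setT)
    (fun i => @pc_compact (vertex i)).
  by congr compact; apply/seteqP; split.
- by have [u _] := dirI (countable0 _); exists.
- exact: aleph1_directed_ub2.
- move=> j.
  have -> : C j = coord i @^-1` K `&` \bigcap_(k in [set: {k : I | (k <= j)%O}])
      [set t | bond (proj2_sig k) (coord j t) = coord (sval k) t].
    apply/seteqP; split=> t [Kt tE]; split=> // k; first by move=> _; exact: tE.
    by move=> kj; exact: (tE (exist _ k kj)).
  apply: closedI; first by apply: preimage_closed clK => t _; exact: coord_cont.
  apply: closed_bigI => k _; apply: closed_eqfun.
  + exact: poscomp_hausdorff.
  + move=> t; apply: continuous_comp; first exact: coord_cont.
    exact: pcm_continuous.
  + exact: coord_cont.
- move=> j; have [j' [jj' ij']] := aleph1_directed_ub2 dirI j i.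
  have [z Kz] := K0 j' ij'.
  pose t k := if pselect (k <= j')%O is left kj' then bond kj' z
              else projT1 (cid (pt k)).
  have tE k (kj' : (k <= j')%O) : t k = bond kj' z.
    rewrite /t; case: pselect => // h.
    by congr (bond _ z); exact: Prop_irrelevance.
  (* Off the indices below [j'] the coordinates of [t] are arbitrary, which
     membership in [C j'] allows. *)
  exists (t : T); apply: CC jj' _ _; split; first by rewrite /coord (tE _ ij').
  by move=> k kj'; rewrite /coord !tE bond_refl.
- exact: CC.
have [|l lt] := @lift_thread t.
  by move=> j k jk; have [_] := tC k; exact.
by apply: (Kproj l); rewrite lt; case: (tC i).
Qed.

(** * Factoring morphisms out of a codirected limit *)

(** For fixed [n], the pairs with [prj i l <= prj i l'] and not
    [U_n(f l, f l')] form a closed set that decreases with [i]. The common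
    elements satisfy [l <= l'], hence [f l <= f l'], so there are none and the
    set is empty for some [i]. An upper bound of these indices works for all
    [n]. *)
Lemma prj_reflects_image_order (X : poscomp) (f : poscomp_map limobj X) :
  gdelta_order X ->
  exists i, forall l l', (prj i l <= prj i l')%O -> (f l <= f l')%O.
Proof.
move=> [U [oU leU]].
have /choice[u uP] : forall n, exists i, forall l l',
    (prj i l <= prj i l')%O -> U n (f l, f l').
  move=> n; apply: contrapT => /forallNP noi.
  pose C i :=
    (fun p : limobj * limobj => (prj i p.1, prj i p.2)) @^-1`
      [set q | (q.1 <= q.2)%O] `&`
    (fun p : limobj * limobj => (f p.1, f p.2)) @^-1` (~` U n).
  have [||||||[l l'] ll'] :=
    @compact_directed_bigcap (limobj * limobj)%type d I C.
  - by rewrite -setXTT; apply: compact_setX; exact: pc_compact.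
  - by have [i _] := dirI (countable0 _); exists.
  - exact: aleph1_directed_ub2.
  - move=> i; apply: closedI; apply: preimage_closed.
    + by move=> p _; apply: continuous_pairmap; exact: pcm_continuous.
    + exact: pc_closed.
    + by move=> p _; apply: continuous_pairmap; exact: pcm_continuous.
    + exact: open_closedC.
  - move=> i; apply: contrapT => Ci0; apply: (noi i) => l l' ll'.
    by apply: contrapT => nU; apply: Ci0; exists (l, l').
  - move=> i j ij [l l'] [/= ll' nU]; split => //=.
    by rewrite -!(bond_prj ij); exact: pcm_homo.
  have [i _] := dirI (countable0 _).
  have /pcm_homo - /(_ _ f) /leU/(_ n) : (l <= l')%O.
    by apply: prj_le => j; case: (ll' j).
  by case: (ll' i).
have [k uk] := aleph1_directed_seq dirI u.
exists k => l l' ll'; apply/leU => n; apply: uP.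
by rewrite -!(bond_prj (uk n)); exact: pcm_homo.
Qed.

(** The relation [forall n, N n (bond ik z, x)] below is a closed thickening of
    the graph of [f] over [prj i]. It is so thin that it remains
    single-valued and monotone, yet it covers every point of [vertex k] because
    each [N n] is a neighbourhood. *)
Lemma factors_through_vertex (X : poscomp) (f : poscomp_map limobj X) :
  gdelta_order X ->
  exists i (g : poscomp_map (vertex i) X), forall l, g (prj i l) = f l.
Proof.
move=> gX; have [i fi] := prj_reflects_image_order f gX.
have [U [oU leU]] := gX.
pose T : topologicalType := (vertex i * X)%type.
pose G : set T := range (fun l => (prj i l, f l)).
have hausT : hausdorff_space T.
  by apply: hausdorff_setX; exact: poscomp_hausdorff.
have cT : compact [set: T].
  by rewrite -setXTT; apply: compact_setX; exact: pc_compact.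
have clG : closed G.
  apply: compact_closed => //; apply: continuous_compact.
    apply: continuous_subspaceT => l; apply: cvg_pair; exact: pcm_continuous.
  exact: pc_compact.
have /choice[N NP] : forall n, exists N : set T, [/\ closed N,
    forall l, nbhs (prj i l, f l) N &
    forall p q, N p -> N q -> (p.1 <= q.1)%O -> U n (p.2, q.2)].
  move=> n.
  (* The complement of [z <= z'] joined to [U_n]: a square inside [O] says that
     [z <= z'] forces [U_n(x, x')]. *)
  pose O : set (T * T) := (fun pq => (pq.1.1, pq.2.1)) @^-1`
      (~` [set q : vertex i * vertex i | (q.1 <= q.2)%O]) `|`
    (fun pq => (pq.1.2, pq.2.2)) @^-1` U n.
  have [|p q|M [clM GM MU]] := closed_nbhs_square (O := O) hausT cT clG.
  - apply: openU.
      have /continuousP : continuous (fun pq : T * T => (pq.1.1, pq.2.1)).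
        by apply: continuous_pairmap => ?; exact: cvg_fst.
      by apply; apply: closed_openC; exact: pc_closed.
    have /continuousP : continuous (fun pq : T * T => (pq.1.2, pq.2.2)).
      by apply: continuous_pairmap => ?; exact: cvg_snd.
    by apply; exact: oU.
  - move=> [l _ <-] [l' _ <-] /=.
    have [/fi/leU/(_ n)|] := pselect (prj i l <= prj i l')%O; first by right.
    by left.
  exists M; split=> // [l|p q Mp Mq pq]; first by apply: GM; exists l.
  by have [] := MU _ _ Mp Mq.
(* Nested versions of the [N n], so that compactness of [X] applies to their
   slices. *)
pose N' n : set T := [set p | forall m, (m <= n)%N -> N m p].
have GN' l n : nbhs ((prj i l, f l) : T) (N' n).
  elim: n => [|n IHn].
    have [_ /(_ l) + _] := NP 0%N; apply: filterS => p Np m.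
    by rewrite leqn0 => /eqP ->.
  have [_ /(_ l) GN _] := NP n.+1.
  apply: filterS (filterI IHn GN) => p [N'p Np] m.
  by rewrite leq_eqVlt => /predU1P[-> //|]; exact: N'p.
have N'_anti m n : (m <= n)%N -> N' n `<=` N' m.
  by move=> mn p Np q qm; apply: Np; exact: leq_trans qm mn.
have clN' n : closed (N' n).
  rewrite (_ : N' n = \bigcap_(m in [set m | (m <= n)%N]) N m) //.
  by apply: closed_bigI => m _; case: (NP m).
have /choice[u uP] : forall n, exists j, exists (ij : (i <= j)%O),
    forall z, exists x, N' n (bond ij z, x).
  move=> n.
  (* Asking for a neighbourhood of [(z, x)] makes the complement of this set
     open. *)
  pose K := [set z : vertex i | ~ exists x, nbhs ((z, x) : T) (N' n)].
  have [||j [ij jK]] := @bond_image_avoids i K.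
  - move=> z clz [x /nbhs_interior[[A B] /= [zA xB] ABN]].
    have [z' [Kz' Az']] := clz _ zA; apply: Kz'; exists x.
    by apply: (ABN (z', x)); split=> //=; exact: nbhs_singleton.
  - by move=> l; apply; exists (f l).
  exists j, ij => z; have /contrapT[x Nx] := jK z.
  by exists x; exact: nbhs_singleton Nx.
have [k uk] := aleph1_directed_seq dirI u.
have ik : (i <= k)%O by have [iu _] := uP 0%N; exact: le_trans iu (uk 0%N).
have /choice[g gP] : forall z, exists x, forall n, N n (bond ik z, x).
  move=> z.
  have [|||||| x xP] := @compact_directed_bigcap X _ nat
    (fun n => [set x | N' n (bond ik z, x)]).
  - exact: pc_compact.
  - exact: (inhabits 0%N).
  - by move=> m n; exists (maxn m n); rewrite !leEnat leq_maxl leq_maxr.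
  - move=> n.
    apply: (@preimage_closed _ _ (fun x : X => (bond ik z, x) : T) (N' n)).
      move=> x _; apply: continuous_pairing => ?; first exact: cvg_cst.
      exact: cvg_id.
    exact: clN'.
  - move=> n; have [iu] := uP n; move=> /(_ (bond (uk n) z))[x Nx].
    by exists x; rewrite /= -(bond_bond iu (uk n)).
  - by move=> m n mn x; exact: N'_anti.
  by exists x => n; exact: (xP n).
have gU z z' x x' : (z <= z')%O -> (forall n, N n (bond ik z, x)) ->
    (forall n, N n (bond ik z', x')) -> (x <= x')%O.
  move=> zz' Nx Nx'; apply/leU => n; have [_ _ NU] := NP n.
  by apply: NU (Nx n) (Nx' n) _; exact: pcm_homo.
have gE z x : (forall n, N n (bond ik z, x)) -> x = g z.
  by move=> Nx; apply: le_anti; rewrite !(@gU z z).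
have ghomo : {homo g : z z' / (z <= z')%O}.
  by move=> z z' zz'; exact: gU zz' _ _.
have gcont : continuous g.
  apply: closed_graph_continuous; first exact: pc_compact.
  rewrite (_ : [set p | _] = \bigcap_n
      (fun p : vertex k * X => (bond ik p.1, p.2) : T) @^-1` N n).
    apply: closed_bigI => n _; apply: preimage_closed; last by case: (NP n).
    move=> p _; apply: (@continuous_pairmap _ _ _ _ (bond ik) id).
      exact: pcm_continuous.
    by move=> x; exact: cvg_id.
  apply/seteqP; split=> [[z x] /= -> n _|[z x] Nx]; first exact: gP.
  by apply: gE => n; exact: Nx.
exists k, (PosCompMap ghomo gcont) => l /=; apply/esym/gE => n.
by rewrite bond_prj; apply: nbhs_singleton; case: (NP n).
Qed.

(** For each [n], the points at which [g] and [g'] are [U_n]-related in both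
    directions form an open set containing the image of the limit. *)
Lemma factorization_unique (X : poscomp) i (g g' : poscomp_map (vertex i) X) :
  gdelta_order X -> (forall l, g (prj i l) = g' (prj i l)) ->
  exists j (ij : (i <= j)%O), forall z, g (bond ij z) = g' (bond ij z).
Proof.
move=> [U [oU leU]] gg'.
pose V n := [set z : vertex i | U n (g z, g' z) /\ U n (g' z, g z)].
have /choice[u uP] : forall n, exists j, exists (ij : (i <= j)%O),
    forall z, V n (bond ij z).
  move=> n; have [||j [ij jV]] := @bond_image_avoids i (~` V n).
  - apply: open_closedC; apply: openI.
      have /continuousP : continuous (fun z => (g z, g' z)).
        by apply: continuous_pairing; exact: pcm_continuous.
      by apply; exact: oU.
    have /continuousP : continuous (fun z => (g' z, g z)).
      by apply: continuous_pairing; exact: pcm_continuous.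
    by apply; exact: oU.
  - by move=> l; apply; split; apply: (leU _ _).1; rewrite gg'.
  by exists j, ij => z; apply: contrapT; exact: jV.
have [k uk] := aleph1_directed_seq dirI u.
have ik : (i <= k)%O by have [iu _] := uP 0%N; exact: le_trans iu (uk 0%N).
have Vk n z : V n (bond ik z).
  have [iu Vu] := uP n.
  by rewrite -(bond_bond iu (uk n)); exact: Vu.
exists k, ik => z; apply: le_anti; apply/andP; split; apply/leU => n;
  by case: (Vk n z).
Qed.

End CodirectedLimit.

(** * Metrisable spaces are copresentable *)

Theorem theorem5p15 (R : realType) (X : poscomp) (hX : metrisable R X) :
  @aleph1_copresentable POSCOMP X.
Proof.
move=> d I dirI D L limL K.
have gX := metrisable_gdelta_order hX.
pose kleg i (g : poscomp_map (vertex D i) X) : apex K := leg K i g.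
have kleg_bond i j (ij : (i <= j)%O) (g : poscomp_map (vertex D i) X) :
    kleg j (poscomp_comp g (bond D ij)) = kleg i g.
  exact: (congr1 (fun k => k g) (@leg_natural _ _ _ K i j ij)).
have kleg_eq i j (g : poscomp_map (vertex D i) X)
    (g' : poscomp_map (vertex D j) X) :
    (forall l, g (prj L i l) = g' (prj L j l)) -> kleg i g = kleg j g'.
  move=> gg'; have [k [ik jk]] := aleph1_directed_ub2 dirI i j.
  rewrite -(kleg_bond _ _ ik) -(kleg_bond _ _ jk).
  have [|m [km gm]] := factorization_unique dirI limL
    (g := poscomp_comp g (bond D ik)) (g' := poscomp_comp g' (bond D jk)) gX.
    by move=> l /=; rewrite !bond_prj.
  rewrite -(kleg_bond _ _ km) -[RHS](kleg_bond _ _ km).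
  by congr (kleg m); apply: poscomp_map_ext => z; exact: gm.
(* The mediating map sends [f] to the value of the cocone at any factorisation
   of [f] through a vertex. *)
have /choice[h hP] : forall f : poscomp_map (limobj L) X, exists x,
    forall i (g : poscomp_map (vertex D i) X),
    (forall l, g (prj L i l) = f l) -> x = kleg i g.
  move=> f; have [i [g gf]] := factors_through_vertex dirI limL f gX.
  by exists (kleg i g) => j g' g'f; apply: kleg_eq => l; rewrite gf g'f.
exists h; split=> [i|h' h'E].
  by apply/funext => g; exact: hP.
apply/funext => f; have [i [g gf]] := factors_through_vertex dirI limL f gX.
rewrite (hP f i g gf) -[LHS](congr1 (fun k => k g) (h'E i)) /=.
by congr (h' _); apply: poscomp_map_ext => l; rewrite /= gf.
Qed.
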